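(* Let $(A,d_A)$ be a locally finite metric space and let $X$ be a Banach space. Suppose that the finite subsets of $A$ admit uniformly coarse embeddings into $X$, that is, there are non-decreasing functions $\rho_1,\rho_2:[0,\infty)\to[0,\infty)$ with $\lim_{t\to\infty}\rho_1(t)=\infty$ such that for every finite subset $F\subset A$ there is a map $f_F:F\to X$ satisfying $$\forall u,v\in F\quad \rho_1(d_A(u,v))\le \|f_F(u)-f_F(v)\|\le\rho_2(d_A(u,v)).$$ Then $A$ admits a coarse embedding into $X$.
   Context: A metric space $(A,d_A)$ is called discrete if there exists a constant $\delta>0$ such that $d_A(u,v)\ge\delta$ for all $u,v\in A$ with $u\neq v$. A discrete metric space $A$ is called locally finite if for every $u\in A$ and every $r>0$ the set $\{a\in A: d_A(u,a)\le r\}$ is finite. A map $f:(Z,d_Z)\to(Y,d_Y)$ between metric spaces is called a coarse embedding if there exist non-decreasing functions $\rho_1,\rho_2:[0,\infty)\to[0,\infty)$ such that $\lim_{t\to\infty}\rho_1(t)=\infty$ and $$\forall u,v\in Z\quad \rho_1(d_Z(u,v))\le d_Y(f(u),f(v))\le\rho_2(d_Z(u,v)).$$ (A coarse embedding is not required to be injective or continuous.) A Banach space is regarded as a metric space with the metric $\|x-y\|$. *)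

(* Defs.v *)
From mathcomp Require Import all_boot all_order all_algebra.
From mathcomp Require Import all_classical all_reals all_analysis.

Set Implicit Arguments.
Unset Strict Implicit.
Unset Printing Implicit Defensive.

Import Order.TTheory GRing.Theory Num.Theory.
Import numFieldNormedType.Exports.

Local Open Scope classical_set_scope.
Local Open Scope ring_scope.

Definition discrete_metric (R : realType) (A : metricType R) : Prop :=
  exists2 delta : R, 0 < delta &
    forall u v : A, u <> v -> delta <= mdist u v.

Definition locally_finite_metric (R : realType) (A : metricType R) : Prop :=
  discrete_metric A /\
  forall (u : A) (r : R), 0 < r -> finite_set [set a : A | mdist u a <= r].

(* A function [0, oo) -> [0, oo) is encoded as a total function R -> R that is
   only constrained, and only ever evaluated, on nonnegative arguments. *)
Definition nondecreasing_nonneg (R : realType) (rho : R -> R) : Prop :=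
  (forall t, 0 <= t -> 0 <= rho t) /\
  (forall s t, 0 <= s -> s <= t -> rho s <= rho t).

Definition coarse_controls (R : realType) (rho1 rho2 : R -> R) : Prop :=
  [/\ nondecreasing_nonneg rho1, nondecreasing_nonneg rho2 &
      rho1 t @[t --> +oo] --> +oo].

(* The metrics are explicit arguments because a normed module carries no
   metricType instance, and because subsets are used with the induced metric. *)
Definition coarsely_bounded (R : realType) (rho1 rho2 : R -> R)
    (Z Y : Type) (dZ : Z -> Z -> R) (dY : Y -> Y -> R) (f : Z -> Y) : Prop :=
  forall u v : Z, rho1 (dZ u v) <= dY (f u) (f v) <= rho2 (dZ u v).

Definition coarse_embedding (R : realType) (Z Y : Type)
    (dZ : Z -> Z -> R) (dY : Y -> Y -> R) (f : Z -> Y) : Prop :=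
  exists rho1 rho2 : R -> R,
    coarse_controls rho1 rho2 /\ coarsely_bounded rho1 rho2 dZ dY f.

Definition norm_dist (R : realType) (X : normedModType R) (x y : X) : R :=
  `|x - y|.

Definition induced_dist (R : realType) (A : metricType R) (F : set A)
    (u v : F) : R :=
  mdist (val u) (val v).

Definition finite_subsets_uniformly_coarsely_embed (R : realType)
    (A : metricType R) (X : normedModType R) : Prop :=
  exists rho1 rho2 : R -> R,
    coarse_controls rho1 rho2 /\
    forall F : set A, finite_set F ->
      exists f : F -> X,
        coarsely_bounded rho1 rho2 (@induced_dist R A F) (@norm_dist R X) f.

(* Main.v *)
Require Import Defs.
From mathcomp Require Import all_boot all_order all_algebra.
From mathcomp Require Import all_classical all_reals all_analysis.
From mathcomp Require Import ring lra.

(* Embed larger and larger balls around a base point [a0] by maps [F n] with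
   [F n a0 = 0], fix a free ultrafilter [U], and let [N u] be the [U]-limit of
   [`|F n u|].  A map on [A] is obtained by gluing: [f u] is the sum of
   [tent k (phi u) *: F (n k) u] where [phi] is a logarithm of [1 + N], so that
   the tents form a partition of unity on annuli and vary slowly enough for the
   upper bound to survive.

   For the lower bound the indices [n k] are chosen so that the norms of sums
   [x (n k) + y (n k.+1) + z (n k.+2)] are close to the iterated [U]-limit [L].
   Write [q x] for the iterated limit of [`|x a - x b|].  Changing one index
   only does not change [L], so [q x], [q y], [q z] are at most [2 L]; moving
   all the indices to a common one costs [q x + q y + q z], so the limit of
   [`|x n + y n + z n|] is at most [7 L].  Hence no independence between the
   ranges of the different [F n] is needed.  Points in distant annuli are
   separated by their norms. *)

Set Implicit Arguments.
Unset Strict Implicit.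
Unset Printing Implicit Defensive.

Import Order.TTheory GRing.Theory Num.Theory.
Import numFieldNormedType.Exports.

Local Open Scope classical_set_scope.
Local Open Scope ring_scope.

Lemma addrB3 (V : zmodType) (u v w u' v' w' : V) :
  u + v + w - (u' + v' + w') = (u - u') + (v - v') + (w - w').
Proof. by rewrite opprD addrACA; congr (_ + _); rewrite opprD addrACA. Qed.

(** * Limits of bounded real families along an ultrafilter *)

Section UltraLimit.
Context {R : realType} {I : Type} (U : set_system I) {UU : UltraFilter U}.

Let UP : ProperFilter U := @ultra_proper _ _ UU.
#[local] Existing Instance UP.

Definition bounded_fam (g : I -> R) := exists M : R, forall n, `|g n| <= M.

Definition ulim (g : I -> R) : R := lim (g @ U).

Lemma bounded_fam_cst (c : R) : bounded_fam (fun=> c).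
Proof. by exists `|c|. Qed.

Lemma bounded_famD (g h : I -> R) :
  bounded_fam g -> bounded_fam h -> bounded_fam (fun n => g n + h n).
Proof.
move=> [M gM] [N hN]; exists (M + N) => n.
by rewrite (le_trans (ler_normD _ _))// lerD.
Qed.

(** The image of [U] clusters at some [p] of a compact segment. If the preimage of a neighbourhood
    of [p] were not in [U], its complement would be, contradicting clustering. *)
Lemma ulim_cvg (g : I -> R) : bounded_fam g -> g @ U --> ulim g.
Proof.
move=> [M gM].
have gI : (g @ U) [set` `[- M, M]].
  by apply: (@filterE _ U) => n /=; rewrite in_itv/= -ler_norml gM.
have [p [_ gp]] := @segment_compact R (- M) M (g @ U) _ gI.
suff gUp : g @ U --> p by apply/cvg_ex; exists p.
move=> B pB; have [//|UnB] := in_ultra_setVsetC (g @^-1` B) UU.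
by have [y []] := gp (~` B) B UnB pB.
Qed.

Lemma ulim_le_near (g h : I -> R) : bounded_fam g -> bounded_fam h ->
  (\forall n \near U, g n <= h n) -> ulim g <= ulim h.
Proof.
move=> bg bh gh; rewrite -subr_ge0.
apply: (cvgr_to_ge (cvgB (ulim_cvg bh) (ulim_cvg bg))).
by apply: filterS gh => n; rewrite subr_ge0.
Qed.

Lemma ulim_le (g h : I -> R) : bounded_fam g -> bounded_fam h ->
  (forall n, g n <= h n) -> ulim g <= ulim h.
Proof. by move=> bg bh gh; apply: ulim_le_near => //; exact: filterE. Qed.

Lemma ulim_cst (c : R) : ulim (fun=> c) = c.
Proof. by apply/cvg_lim => //; exact: cvg_cst. Qed.

Lemma ulimD (g h : I -> R) : bounded_fam g -> bounded_fam h ->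
  ulim (fun n => g n + h n) = ulim g + ulim h.
Proof. by move=> bg bh; apply/cvg_lim => //; apply: cvgD; exact: ulim_cvg. Qed.

Lemma ulim_norm_le (g : I -> R) (M : R) :
  (forall n, `|g n| <= M) -> `|ulim g| <= M.
Proof.
move=> gM; have bg : bounded_fam g by exists M.
rewrite ler_norml -{1}[- M]ulim_cst -{2}[M]ulim_cst.
by apply/andP; split; apply: ulim_le; (try exact: bounded_fam_cst) => // n;
  move: (gM n); rewrite ler_norml => /andP[].
Qed.

Lemma ulim_near (g : I -> R) (e : R) : bounded_fam g -> 0 < e ->
  \forall n \near U, `|ulim g - g n| < e.
Proof. by move=> /ulim_cvg /cvgrPdist_lt; apply. Qed.

End UltraLimit.

Arguments ulim_cst {R I} U {UU} c.

(** * Iterated limits of norms of three-term sums *)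

Section Oscillation.
Context {R : realType} {I : Type} (U : set_system I) {UU : UltraFilter U}.
Context {X : normedModType R}.
Implicit Types x y z : I -> X.

Let UP : ProperFilter U := @ultra_proper _ _ UU.
#[local] Existing Instance UP.

Definition bounded_vec (x : I -> X) := exists M : R, forall n, `|x n| <= M.

Definition oscillation (x : I -> X) : R :=
  ulim U (fun a => ulim U (fun b => `|x a - x b|)).

Lemma bounded_ulim (J : Type) (g : J -> I -> R) :
  (exists M : R, forall j n, `|g j n| <= M) ->
  bounded_fam (fun j => ulim U (g j)).
Proof. by move=> [M gM]; exists M => j; exact: ulim_norm_le. Qed.

Lemma bounded_dist x : bounded_vec x ->
  (exists M : R, forall a b, `| `|x a - x b| | <= M).
Proof.
move=> [M xM]; exists (M + M) => a b.
by rewrite normr_id (le_trans (ler_normB _ _))// lerD.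
Qed.

Lemma bounded_dist1 x a : bounded_vec x -> bounded_fam (fun b => `|x a - x b|).
Proof. by move=> /bounded_dist[M xM]; exists M => b. Qed.

Lemma oscillation_le x (G : I -> R) : bounded_vec x -> bounded_fam G ->
  (forall a b, `|x a - x b| <= G a + G b) -> oscillation x <= ulim U G + ulim U G.
Proof.
move=> bx bG xG; rewrite /oscillation -{2}[ulim U G](ulim_cst U) -ulimD//; last first.
  exact: bounded_fam_cst.
apply: ulim_le.
- by apply: bounded_ulim; exact: bounded_dist.
- by apply: bounded_famD => //; exact: bounded_fam_cst.
move=> a; rewrite -[G a](ulim_cst U) -ulimD//; last exact: bounded_fam_cst.
apply: ulim_le => //; first exact: bounded_dist1.
by apply: bounded_famD => //; exact: bounded_fam_cst.
Qed.

Definition iterated_norm (x y z : I -> X) : R :=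
  ulim U (fun a => ulim U (fun b => ulim U (fun c => `|x a + y b + z c|))).

Section Triple.
Variables x y z : I -> X.
Hypotheses (bx : bounded_vec x) (bY : bounded_vec y) (bz : bounded_vec z).

Lemma bounded_triple : exists M : R, forall a b c, `| `|x a + y b + z c| | <= M.
Proof.
case: bx bY bz => [Mx xM] [My yM] [Mz zM]; exists (Mx + My + Mz) => a b c.
rewrite normr_id (le_trans (ler_normD _ _))// lerD//.
by rewrite (le_trans (ler_normD _ _))// lerD.
Qed.

Let G2 a b := ulim U (fun c => `|x a + y b + z c|).
Let G1 a := ulim U (G2 a).
Let iterated_normE : iterated_norm x y z = ulim U G1. Proof. by []. Qed.

Lemma bounded_triple3 a b : bounded_fam (fun c => `|x a + y b + z c|).
Proof. by have [M MP] := bounded_triple; exists M. Qed.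

Lemma bounded_triple2 a : bounded_fam (G2 a).
Proof. by apply: bounded_ulim; have [M MP] := bounded_triple; exists M. Qed.

Lemma bounded_triple1 : bounded_fam G1.
Proof.
apply: bounded_ulim; have [M MP] := bounded_triple; exists M => a b.
exact: ulim_norm_le.
Qed.

#[local] Hint Resolve bounded_fam_cst bounded_triple3 bounded_triple2
  bounded_triple1 : core.

(* The summand whose index runs over the ultrafilter can be isolated by
   changing that index alone: the two resulting sums differ by [x a - x a']. *)
Lemma oscillation_le_iterated :
  [/\ oscillation x <= 2 * iterated_norm x y z,
      oscillation y <= 2 * iterated_norm x y z &
      oscillation z <= 2 * iterated_norm x y z].
Proof.
rewrite iterated_normE.
have dbl (r : R) : 2 * r = r + r by lra.
have tri (u v w : X) : `|u - v| <= `|w + u| + `|w + v|.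
  by rewrite -[u - v](addrKA w) (addrC u) ler_normB.
have mono1 (r : R) : (forall a, r <= 2 * G1 a) -> r <= 2 * ulim U G1.
  move=> rG; rewrite dbl -[r](ulim_cst U) -ulimD//; apply: ulim_le => //.
    exact: bounded_famD.
  by move=> a; rewrite -dbl.
have mono2 (r : R) a : (forall b, r <= 2 * G2 a b) -> r <= 2 * G1 a.
  move=> rG; rewrite dbl -[r](ulim_cst U) -ulimD//; apply: ulim_le => //.
    exact: bounded_famD.
  by move=> b; rewrite -dbl.
split.
- rewrite dbl; apply: oscillation_le => // a a'.
  rewrite -[`|_|](ulim_cst U) -ulimD//; apply: ulim_le => //.
    exact: bounded_famD.
  move=> b; rewrite -[`|_|](ulim_cst U) -ulimD//; apply: ulim_le => //.
    exact: bounded_famD.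
  by move=> c; have := tri (x a) (x a') (y b + z c); rewrite !(addrC (y b + z c)) !addrA.
- apply: mono1 => a; rewrite dbl; apply: oscillation_le => // b b'.
  rewrite -[`|_|](ulim_cst U) -ulimD//; apply: ulim_le => //.
    exact: bounded_famD.
  by move=> c; rewrite !(addrAC _ _ (z c)) tri.
- apply: mono1 => a; apply: mono2 => b; rewrite dbl.
  by apply: oscillation_le => // c c'; exact: tri.
Qed.

(** Writing [x n] as [x a - (x a - x n)], and likewise [y] with [b] and [z] with [c], costs the
    limiting distances [d], whose own limits are the oscillations. *)
Lemma ulim_norm_sum_le :
  ulim U (fun n => `|x n + y n + z n|) <=
  iterated_norm x y z + (oscillation x + oscillation y + oscillation z).
Proof.
pose d (w : I -> X) a := ulim U (fun b => `|w a - w b|).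
have bd w : bounded_vec w -> bounded_fam (d w).
  by move=> bw; apply: bounded_ulim; exact: bounded_dist.
have bdx := bd _ bx; have bdy := bd _ bY; have bdz := bd _ bz.
set p := ulim U _.
have p3 a b c : p <= `|x a + y b + z c| + (d x a + d y b + d z c).
  rewrite -[`|x a + y b + z c|](ulim_cst U) /d -!ulimD//;
    try (by repeat apply: bounded_famD; try exact: bounded_dist1);
    try exact: bounded_dist1.
  apply: ulim_le; first by have [M MP] := bounded_triple; exists M.
    by repeat apply: bounded_famD; try exact: bounded_dist1.
  move=> n; rewrite (_ : x n + y n + z n = (x a + y b + z c) -
    ((x a - x n) + (y b - y n) + (z c - z n))).
    rewrite (le_trans (ler_normB _ _))// lerD2l.
    rewrite (le_trans (ler_normD _ _))// lerD2r.
    exact: ler_normD.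
  by rewrite addrB3 !subKr.
(* Limits are taken one at a time, innermost index [c] first; each turns one [d] term into an
   oscillation. *)
have step (k : R) (g h : I -> R) : bounded_fam g -> bounded_fam h ->
    (forall n, p <= g n + (h n + k)) -> p <= ulim U g + (ulim U h + k).
  move=> bg bh pgh; rewrite -[p](ulim_cst U) -[k](ulim_cst U) -!ulimD//.
    by apply: ulim_le => //; repeat apply: bounded_famD.
  exact: bounded_famD.
have p2 a b : p <= G2 a b + (oscillation z + (d x a + d y b)).
  by apply: (step _ _ (d z)) => // c; have := p3 a b c; lra.
have p1 a : p <= G1 a + (oscillation y + (oscillation z + d x a)).
  by apply: (step _ _ (d y)) => // b; have := p2 a b; lra.
rewrite iterated_normE -!addrA; apply: (step _ _ (d x)) => // a.
by have := p1 a; lra.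
Qed.

Lemma near_triple (e : R) : 0 < e ->
  \forall a \near U, \forall b \near U, \forall c \near U,
    ulim U (fun n => `|x n + y n + z n|) <= 7 * `|x a + y b + z c| + e.
Proof.
(* Three approximations within [e / 21] lose [e / 7] on the iterated norm; the factor
   [7 = 1 + 2 + 2 + 2] turns this into [e]. *)
move=> e0; have e21 : 0 < e / 21 by lra.
have [q1 q2 q3] := oscillation_le_iterated.
have := ulim_norm_sum_le; set p := ulim U _ => pL.
have n1 := ulim_near (UU:=UU) bounded_triple1 e21.
apply: (@filterS _ U _ _ _ _ n1) => a; rewrite ltr_norml => /andP[_ h1].
apply: (@filterS _ U _ _ _ _ (ulim_near (UU:=UU) (bounded_triple2 a) e21)) => b.
rewrite ltr_norml => /andP[_ h2].
apply: (@filterS _ U _ _ _ _ (ulim_near (UU:=UU) (bounded_triple3 a b) e21)) => c.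
rewrite ltr_norml => /andP[_ h3].
rewrite -/(iterated_norm x y z) in h1; rewrite -/(G1 a) -/(G2 a b) in h1 h2 h3.
lra.
Qed.

End Triple.
End Oscillation.

(** * Recursive choice of indices along a filter *)

Lemma iterated_selection (I : Type) (U : set_system I) (UP : ProperFilter U)
    (P : nat -> I -> I -> I -> Prop) :
  (forall k, \forall a \near U, \forall b \near U, \forall c \near U, P k a b c) ->
  exists n : nat -> I, forall k, P k (n k) (n k.+1) (n k.+2).
Proof.
move=> PU.
pose P2 k a b := \forall c \near U, P k a b c.
pose P1 k a := \forall b \near U, P2 k a b.
(* The new index serves as last argument at stage [k], middle one at [k.+1] and first one at [k.+2].
   Stating the last two demands as implications makes the choice possible for all [a] and [b]. *)
have next k a b : exists c, [/\ P1 k.+2 c, P1 k.+1 b -> P2 k.+1 b c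
    & P2 k a b -> P k a b c].
  have h1 : \forall c \near U, P1 k.+2 c by exact: PU.
  have h2 : \forall c \near U, P1 k.+1 b -> P2 k.+1 b c.
    by have [p|p] := pselect (P1 k.+1 b); [apply: filterS p|exact: filterE].
  have h3 : \forall c \near U, P2 k a b -> P k a b c.
    by have [p|p] := pselect (P2 k a b); [apply: filterS p|exact: filterE].
  by have [c [? [? ?]]] := filter_ex (filterI h1 (filterI h2 h3)); exists c.
have [a0 Pa0] : exists a, P1 0%N a := filter_ex (PU 0%N).
have [b0 [Pab0 Pb0]] : exists b, P2 0%N a0 b /\ P1 1%N b.
  exact: filter_ex (filterI Pa0 (PU 1%N)).
have /choice[g gP] (t : nat * I * I) := next t.1.1 t.1.2 t.2.
pose s := fix s k := if k is k'.+1 then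
  ((s k').2, g (k', (s k').1, (s k').2)) else (a0, b0).
have sP k : P2 k (s k).1 (s k).2 /\ P1 k.+1 (s k).2.
  by elim: k => [//|k [p2 p1]]; have [g1 g2 g3] := gP (k, (s k).1, (s k).2);
    split => //=; exact: g2.
exists (fun k => (s k).1) => k /=.
have [_ _] := gP (k, (s k).1, (s k).2); apply; exact: (sP k).1.
Qed.

Lemma near_finite_set (I J : Type) (U : set_system I) {UF : Filter U}
    (E : set J) (Q : J -> I -> Prop) : finite_set E ->
  (forall j, E j -> \forall n \near U, Q j n) ->
  \forall n \near U, forall j, E j -> Q j n.
Proof.
(* A choice structure on [J] is needed to enumerate [E] by a sequence. *)
elim/Pchoice: J => J in E Q *.
move=> /finite_seqP[s ->]; elim: s => [|j s IHs] QU.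
  by apply: filterE => n j /=.
have Qj : U (Q j) by apply: QU => /=; exact: mem_head.
have Qs : \forall n \near U, forall j, [set` s] j -> Q j n.
  by apply: IHs => i /= si; apply: QU; rewrite /= in_cons si orbT.
apply: filterS (filterI Qj Qs) => n [qj qs] i /=.
by rewrite in_cons => /predU1P[->//|]; exact: qs.
Qed.

(** * A piecewise linear partition of unity on the half-line *)

Section Tent.
Context {R : realType}.
Implicit Types (s t : R) (k m i : nat).

(** The hat function [max 0 (1 - |t - k|)], written as a negated second difference of truncations so
    that sums over [k] telescope. *)
Definition tent k t : R :=
  2 * Num.min t k%:R - Num.min t (k%:R - 1) - Num.min t (k%:R + 1).

Lemma tent_ge0 k t : 0 <= tent k t.
Proof.
rewrite /tent; case: (leP t k%:R); case: (leP t (k%:R - 1));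
  case: (leP t (k%:R + 1)); lra.
Qed.

Lemma tent_left k t : t <= k%:R - 1 -> tent k t = 0.
Proof.
rewrite /tent; case: (leP t k%:R); case: (leP t (k%:R - 1));
  case: (leP t (k%:R + 1)); lra.
Qed.

Lemma tent_right k t : k%:R + 1 <= t -> tent k t = 0.
Proof.
rewrite /tent; case: (leP t k%:R); case: (leP t (k%:R - 1));
  case: (leP t (k%:R + 1)); lra.
Qed.

Lemma tent_sum3 i t : i%:R <= t -> t <= i%:R + 2 ->
  tent i t + tent i.+1 t + tent i.+2 t = 1.
Proof.
rewrite /tent.
have -> : i.+2%:R = i%:R + 2 :> R by rewrite -addn2 natrD.
have -> : i.+1%:R = i%:R + 1 :> R by rewrite natr1.
have -> : i%:R + 1 - 1 = i%:R :> R by lra.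
have -> : i%:R + 2 - 1 = i%:R + 1 :> R by lra.
have -> : i%:R + 1 + 1 = i%:R + 2 :> R by lra.
case: (leP t (i%:R - 1)); case: (leP t i%:R); case: (leP t (i%:R + 1));
  case: (leP t (i%:R + 2)); case: (leP t (i%:R + 2 + 1)); lra.
Qed.

Lemma sum_tent m t : 0 <= t -> t <= m%:R - 1 -> \sum_(0 <= k < m) tent k t = 1.
Proof.
move=> t0 tm.
have -> : \sum_(0 <= k < m) tent k t =
    1 - (Num.min t m%:R - Num.min t (m%:R - 1)).
  elim: m {tm} => [|m IHm].
    rewrite big_nil; case: (leP t 0%:R); case: (leP t (0%:R - 1)); lra.
  have -> : m.+1%:R - 1 = m%:R :> R by rewrite -natr1 addrK.
  by rewrite big_nat_recr//= IHm /tent natr1; lra.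
case: (leP t m%:R); case: (leP t (m%:R - 1)); lra.
Qed.

(** Here [h k] is the length of the part of [[s, t]] below [k - 1]. A tent varies by the difference
    of two consecutive increments of [h]; both are nonnegative, so their sum bounds it and
    telescopes. *)
Lemma sum_tent_dist m s t : 0 <= s -> s <= t ->
  \sum_(0 <= k < m) `|tent k t - tent k s| <= 2 * (t - s).
Proof.
move=> s0 st.
pose h k : R := Num.min t (k%:R - 1) - Num.min s (k%:R - 1).
have h_le k : h k <= t - s.
  by rewrite /h; case: (leP t (k%:R - 1)); case: (leP s (k%:R - 1)); lra.
suff : \sum_(0 <= k < m) `|tent k t - tent k s| <= h m + h m.+1.
  by have := h_le m; have := h_le m.+1; lra.
elim: m => [|m IHm].
  rewrite big_nil /h subrr.
  by case: (leP t (0%:R - 1)); case: (leP s (0%:R - 1)); case: (leP t 0);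
    case: (leP s 0); lra.
rewrite big_nat_recr//= (le_trans (lerD IHm (lexx _)))//.
suff : `|tent m t - tent m s| <= h m.+2 - h m by lra.
rewrite /h /tent ler_norml.
have -> : m.+2%:R - 1 = m%:R + 1 :> R by rewrite -addn2 natrD; lra.
by case: (leP t (m%:R - 1)); case: (leP t m%:R); case: (leP t (m%:R + 1));
  case: (leP s (m%:R - 1)); case: (leP s m%:R); case: (leP s (m%:R + 1)); lra.
Qed.

End Tent.

(** This is [ln (b / a) <= b / a - 1] times [a]. With [a] and [b] of the form [1 + N], it shows that
    the slow variation of a logarithm offsets the size of the vectors. *)
Lemma mul_ln_diff_le (R : realType) (a b : R) : 0 < a -> a <= b ->
  a * (ln b - ln a) <= b - a.
Proof.
move=> a0 ab; have b0 : 0 < b by lra.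
rewrite -ln_div ?posrE// -ler_pdivlMl//.
have -> : b / a = 1 + a^-1 * (b - a) by field; rewrite gt_eqF.
apply: le_ln1Dx; rewrite (@lt_le_trans _ _ 0)// mulr_ge0 ?invr_ge0//; lra.
Qed.

(** * Gluing the maps [F n] over logarithmic annuli *)

Section Gluing.
Context {R : realType} {A I : Type} {X : normedModType R}.
Context (U : set_system I) {UU : UltraFilter U}.
Variables (F : I -> A -> X) (a0 : A) (w : A -> A -> R).

Let UP : ProperFilter U := @ultra_proper _ _ UU.
#[local] Existing Instance UP.

Let N u : R := ulim U (fun n => `|F n u|).
Let D u v : R := ulim U (fun n => `|F n u - F n v|).

Hypothesis F0 : forall n, F n a0 = 0.
Hypothesis bF : forall u, bounded_vec (fun n => F n u).
Hypothesis wC : forall u v, w u v = w v u.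
Hypothesis Fw : forall u v, \forall n \near U, `|F n u - F n v| <= w u v.
Hypothesis finN : forall r, finite_set [set u | N u <= r].

Let bFn u : bounded_fam (fun n => `|F n u|).
Proof. by have [M FM] := bF u; exists M => n; rewrite normr_id. Qed.

Let bFd u v : bounded_fam (fun n => `|F n u - F n v|).
Proof.
have [M FM] := bF u; have [M' FM'] := bF v; exists (M + M') => n.
by rewrite normr_id (le_trans (ler_normB _ _))// lerD.
Qed.

Let N_ge0 u : 0 <= N u.
Proof.
by rewrite -[0](ulim_cst U); apply: ulim_le => //; exact: bounded_fam_cst.
Qed.

Let D_le u v : D u v <= N u + N v.
Proof.
rewrite /N -ulimD//; apply: ulim_le => //; first exact: bounded_famD.
by move=> n; exact: ler_normB.
Qed.

Let DC u v : D u v = D v u.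
Proof. by congr (ulim U _); apply/funext => n; exact: distrC. Qed.

Let D0 u : D u a0 = N u.
Proof. by congr (ulim U _); apply/funext => n; rewrite F0 subr0. Qed.

Let N_w u v : N u - N v <= w u v.
Proof.
rewrite lerBlDr -[w u v](ulim_cst U) -ulimD//; last exact: bounded_fam_cst.
apply: ulim_le_near => //; first by apply: bounded_famD => //; exact: bounded_fam_cst.
by apply: filterS (Fw u v) => n; have := lerB_dist (F n u) (F n v); lra.
Qed.

(** Logarithms are taken in base [28 = 4 * 7]: once [phi u] exceeds [phi v + 1], the quantity
    [7 * (1 + N v)] is at most a quarter of [1 + N u], which beats the factor 7 lost in bounding
    [N u] by the norm of [f u]. *)
Let C : R := ln 28.

Let C_gt0 : 0 < C.
Proof. by rewrite ln_gt0// ltr1n. Qed.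

Let phi u : R := ln (1 + N u) / C.

Let N1_gt0 u : 0 < 1 + N u.
Proof. by have := N_ge0 u; lra. Qed.

Let phi_ge0 u : 0 <= phi u.
Proof. by rewrite divr_ge0 ?(ltW C_gt0)// ln_ge0// lerDl. Qed.

Let phi_le u v : N u <= N v -> phi u <= phi v.
Proof. by move=> uv; rewrite ler_pM2r ?invr_gt0// ler_ln ?posrE ?lerD2l. Qed.

Let phi_a0 : phi a0 = 0.
Proof.
rewrite /phi /N; under [fun n => `|_|]funext do rewrite F0 normr0.
by rewrite ulim_cst addr0 ln1 mul0r.
Qed.

Let phi_dist u v : N v <= N u ->
  (phi u - phi v) * (N v + 1) <= (N u - N v) / C.
Proof.
move=> vu; rewrite -mulrBl mulrAC ler_pM2r ?invr_gt0//.
have := @mul_ln_diff_le _ (1 + N v) (1 + N u) (N1_gt0 v).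
by rewrite lerD2l => /(_ vu); lra.
Qed.

Let phi_far u v : phi v + 1 < phi u -> 28 * (1 + N v) <= 1 + N u.
Proof.
rewrite -ltrBrDl -mulrBl ltr_pdivlMr// mul1r ltrBrDl => h.
rewrite -ler_ln ?posrE ?mulr_gt0// lnM ?posrE// addrC ltW//.
Qed.

Let phi_fin r : finite_set [set u | phi u <= r].
Proof.
apply: sub_finite_set (finN (expR (r * C))) => u /=.
rewrite ler_pdivrMr// => h.
have : expR (ln (1 + N u)) <= expR (r * C) by rewrite ler_expR.
by rewrite lnK ?posrE//; lra.
Qed.

(** The [k]-th term of [f u - f v] with its index left free. When [phi u] and [phi v] lie in
    [[k, k + 2]], three consecutive parts at a common index [j] add up to [F j u - F j v]. *)
Let part k u v n : X := tent k (phi u) *: F n u - tent k (phi v) *: F n v.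

Let bpart k u v : bounded_vec (part k u v).
Proof.
have [M FM] := bF u; have [M' FM'] := bF v.
exists (tent k (phi u) * M + tent k (phi v) * M') => n.
rewrite (le_trans (ler_normB _ _))// !normrZ !ger0_norm ?tent_ge0//.
by rewrite lerD// ler_wpM2l ?tent_ge0.
Qed.

(** Each stage [k] imposes conditions on finitely many pairs only, since sublevel sets of [phi] are
    finite. The bound [k + 2] is the right end of the window on which tents [k] to [k + 2] sum to
    one. *)
Let selected : exists n : nat -> I, forall k u v,
  phi u <= k%:R + 2 -> phi v <= k%:R + 2 ->
  [/\ `|F (n k) u - F (n k) v| <= w u v, `|F (n k) u| <= N u + 1 &
    ulim U (fun j => `|part k u v j + part k.+1 u v j + part k.+2 u v j|) <=
    7 * `|part k u v (n k) + part k.+1 u v (n k.+1) + part k.+2 u v (n k.+2)|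
      + 1].
Proof.
pose E k := [set u | phi u <= k%:R + 2].
pose P k a b c := forall p, (E k `*` E k) p -> let u := p.1 in let v := p.2 in
  [/\ `|F a u - F a v| <= w u v, `|F a u| <= N u + 1 &
    ulim U (fun j => `|part k u v j + part k.+1 u v j + part k.+2 u v j|) <=
    7 * `|part k u v a + part k.+1 u v b + part k.+2 u v c| + 1].
have [n nP] : exists n : nat -> I, forall k, P k (n k) (n k.+1) (n k.+2).
  apply: (@iterated_selection I U) => k.
  have finE : finite_set (E k `*` E k) by apply: finite_setX; exact: phi_fin.
  have Pk p : (E k `*` E k) p ->
      \forall a \near U, \forall b \near U, \forall c \near U, let u := p.1 in
      let v := p.2 in [/\ `|F a u - F a v| <= w u v, `|F a u| <= N u + 1 &
      ulim U (fun j => `|part k u v j + part k.+1 u v j + part k.+2 u v j|) <=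
      7 * `|part k u v a + part k.+1 u v b + part k.+2 u v c| + 1].
    case: p => u v _ /=.
    have h := near_triple (UU:=UU) (bpart k u v) (bpart k.+1 u v)
      (bpart k.+2 u v) (@ltr01 R).
    have Nu := ulim_near (UU:=UU) (bFn u) (@ltr01 R).
    apply: filterS3 h Nu (Fw u v) => a h Nu Fa.
    apply: filterS h => b; apply: filterS => c h; split => //.
    by move: Nu; rewrite ltr_norml -/(N u) => /andP[]; lra.
  have UF : Filter U by exact _.
  have := near_finite_set (UF:=UF) finE Pk; apply: (@filterS _ U) => a Pa.
  have := near_finite_set (UF:=UF) finE Pa; apply: (@filterS _ U) => b Pb.
  exact: (near_finite_set (UF:=UF) finE Pb).
exists n => k u v uk vk; exact: (nP k (u, v)).
Qed.

Lemma gluing : exists f : A -> X, forall u v,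
  ulim U (fun n => `|F n u - F n v|) <= 20 * `|f u - f v| + 4 /\
  `|f u - f v| <= (1 + 2 / ln 28) * w u v.
Proof.
have [n nP] := selected.
(* Tents of index at least [phi u + 1] vanish at [phi u], so [fE] may use any larger range, in
   particular one common to two points. *)
pose f u := \sum_(0 <= k < (Num.truncn (phi u)).+2) tent k (phi u) *: F (n k) u.
have fE u m : phi u + 1 <= m%:R ->
    f u = \sum_(0 <= k < m) tent k (phi u) *: F (n k) u.
  suff H m1 m2 : (m1 <= m2)%N -> phi u + 1 <= m1%:R ->
      \sum_(0 <= k < m1) tent k (phi u) *: F (n k) u =
      \sum_(0 <= k < m2) tent k (phi u) *: F (n k) u.
    move=> um; have um' : phi u + 1 <= (Num.truncn (phi u)).+2%:R.
      by rewrite -natr1 lerD2r ltW// truncnS_gt.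
    by case: (leqP m (Num.truncn (phi u)).+2) => mm;
      [rewrite (H _ _ mm um)|rewrite -(H _ _ (ltnW mm) um')].
  move=> m12 um1; rewrite (big_cat_nat (leq0n m1) m12)//= [X in _ + X]big_nat [X in _ + X]big1 ?addr0//.
  move=> k /andP[mk _]; rewrite tent_left ?scale0r//.
  by rewrite lerBrDr (le_trans um1)// ler_nat.
have f3 i u : i%:R <= phi u -> phi u <= i%:R + 2 ->
    f u = tent i (phi u) *: F (n i) u + tent i.+1 (phi u) *: F (n i.+1) u
        + tent i.+2 (phi u) *: F (n i.+2) u.
  move=> iu ui; rewrite (fE u i.+3); last by rewrite -addn3 natrD; lra.
  rewrite !big_nat_recr//= big_nat big1 ?add0r// => k /andP[_ ki].
  by rewrite tent_right ?scale0r// (le_trans _ iu)// natr1 ler_nat.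
have near i u v : i%:R <= phi u -> phi u <= i%:R + 2 ->
    i%:R <= phi v -> phi v <= i%:R + 2 -> D u v <= 7 * `|f u - f v| + 1.
  move=> iu ui iv vi; have [_ _] := nP i u v ui vi.
  rewrite (f3 i u)// (f3 i v)// addrB3; congr (_ <= _).
  congr (ulim U _); apply/funext => j.
  by rewrite /part -addrB3 -!scalerDl !tent_sum3// !scale1r.
have trunc_le u : (Num.truncn (phi u))%:R <= phi u by rewrite truncn_le.
have le_trunc u : phi u <= (Num.truncn (phi u))%:R + 1.
  by rewrite natr1 ltW// truncnS_gt.
have N_f u : N u <= 7 * `|f u| + 1.
  (* The selection is applied to the pair [u], [a0]: although [phi a0 = 0] may lie outside the
     window, [F j a0 = 0] makes its tents irrelevant. *)
  have part0 k j : part k u a0 j = tent k (phi u) *: F j u.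
    by rewrite /part F0 scaler0 subr0.
  have ui : phi u <= (Num.truncn (phi u))%:R + 2 by have := le_trunc u; lra.
  have vi : phi a0 <= (Num.truncn (phi u))%:R + 2 by rewrite phi_a0 addr_ge0.
  have [_ _] := nP _ u a0 ui vi.
  rewrite !part0 -f3//; congr (_ <= _); congr (ulim U _); apply/funext => j.
  by rewrite !part0 -!scalerDl tent_sum3// scale1r.
have f_N u : `|f u| <= N u + 1.
  have ui := le_trunc u; have iu := trunc_le u; set i := Num.truncn _ in ui iu.
  (* Thus [f u] is a convex combination of three vectors of norm at most [N u + 1]. *)
  have Fk k : (i <= k)%N -> `|tent k (phi u) *: F (n k) u| <= tent k (phi u) * (N u + 1).
    rewrite -(ler_nat R) => ik; rewrite normrZ ger0_norm ?tent_ge0//.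
    rewrite ler_wpM2l ?tent_ge0//.
    have uk : phi u <= k%:R + 2 by lra.
    by have [_] := nP _ _ _ uk uk.
  rewrite (f3 i u)//; last by lra.
  have -> : N u + 1 = tent i (phi u) * (N u + 1) + tent i.+1 (phi u) * (N u + 1)
      + tent i.+2 (phi u) * (N u + 1).
    by rewrite -!mulrDl tent_sum3 ?mul1r//; lra.
  apply/(le_trans (ler_normD _ _))/lerD; last by rewrite Fk ?leqW.
  by apply/(le_trans (ler_normD _ _))/lerD; apply: Fk.
exists f => u v.
wlog vu : u v / N v <= N u.
  move=> H; have [/H//|/ltW/H] := leP (N v) (N u).
  by rewrite -/(D u v) -/(D v u) DC distrC wC.
split.
  rewrite -/(D u v); have [far|close] := ltP (phi v + 1) (phi u).
    have := phi_far far; have := D_le u v; have := N_f u; have := f_N v.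
    have := lerB_dist (f u) (f v); have := N_ge0 v; lra.
  (* Both values of [phi] lie in [[i, i + 2]] for [i] the integer part of [phi v], so one window
     serves both points. *)
  have uv := phi_le vu; have iv := trunc_le v; have vi := le_trunc v.
  have : D u v <= 7 * `|f u - f v| + 1 by apply: (near (Num.truncn (phi v))); lra.
  by have := normr_ge0 (f u - f v); lra.
pose m := (Num.truncn (phi u)).+2.
have um : phi u + 1 <= m%:R by rewrite -natr1 lerD2r ltW// truncnS_gt.
have phi_vu := phi_le vu; have w0 := N_w u v.
rewrite (fE u m)// (fE v m) -?sumrB; last by lra.
have term k : `|tent k (phi u) *: F (n k) u - tent k (phi v) *: F (n k) v| <=
    tent k (phi u) * w u v + `|tent k (phi u) - tent k (phi v)| * (N v + 1).
  have [kv|vk] := leP (k%:R + 1) (phi v).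
    have ku := le_trans kv phi_vu.
    by rewrite (tent_right kv) (tent_right ku) !scale0r !subrr !normr0 !mul0r addr0.
  have vk2 : phi v <= k%:R + 2 by lra.
  have [_ Fv _] := nP k _ _ vk2 vk2.
  have -> : tent k (phi u) *: F (n k) u - tent k (phi v) *: F (n k) v =
      tent k (phi u) *: (F (n k) u - F (n k) v) +
      (tent k (phi u) - tent k (phi v)) *: F (n k) v.
    by rewrite scalerBr (scalerBl (tent k (phi u))) subrKA.
  rewrite (le_trans (ler_normD _ _))// !normrZ (ger0_norm (tent_ge0 _ _)).
  apply: lerD; last by rewrite ler_wpM2l.
  (* If [u] lies beyond tent [k], the selection may say nothing about [F (n k) u], but its
     coefficient is zero. *)
  have [ku|uk] := leP (k%:R + 1) (phi u); first by rewrite tent_right// !mul0r.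
  have uk2 : phi u <= k%:R + 2 by lra.
  by have [Fuv _ _] := nP k _ _ uk2 vk2; rewrite ler_wpM2l ?tent_ge0.
(* The first summands total [w u v]. The others total at most [2 * (phi u - phi v) * (N v + 1)],
   hence at most [2 * w u v / C]. *)
rewrite (le_trans (ler_norm_sum _ _ _))// (le_trans (ler_sum _ (fun k _ => term k)))//.
rewrite big_split/= -!mulr_suml sum_tent//; last by lra.
have Nv0 := N_ge0 v; have Nv1 : 0 <= N v + 1 by lra.
have := ler_wpM2r Nv1 (sum_tent_dist m (phi_ge0 v) phi_vu).
have := phi_dist vu; have : (N u - N v) / C <= w u v / C by rewrite ler_pM2r ?invr_gt0.
rewrite -/C; lra.
Qed.
End Gluing.

(** * Control functions and the embedding of [A] *)

Lemma coarse_controls_affine (R : realType) (rho1 rho2 : R -> R) (a b c : R) :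
  0 < a -> 0 <= b -> 0 <= c -> coarse_controls rho1 rho2 ->
  coarse_controls (fun t => Num.max 0 ((rho1 t - b) / a)) (fun t => c * rho2 t).
Proof.
move=> a0 b0 c0 [[r1 m1] [r2 m2] cvg1]; split.
- split=> [t _|s t s0 st]; first by rewrite le_max lexx.
  rewrite ge_max !le_max lexx/= ler_pM2r ?invr_gt0// lerD2r.
  by rewrite m1 ?orbT.
- split=> [t t0|s t s0 st]; first by rewrite mulr_ge0 ?r2.
  by rewrite ler_wpM2l ?m2.
- apply/cvgryPge => M; move/cvgryPge : cvg1 => /(_ (M * a + b)).
  apply: filterS => t Mt.
  by rewrite le_max ler_pdivlMr// lerBrDr Mt orbT.
Qed.

Theorem theorem1p3 (R : realType) (A : metricType R)
    (X : completeNormedModType R)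
    (hA : locally_finite_metric A)
    (hfin : finite_subsets_uniformly_coarsely_embed A X) :
  exists f : A -> X, coarse_embedding (@mdist R A) (@norm_dist R X) f.
Proof.
have [_ finA] := hA; have [rho1 [rho2 [rhoP emb]]] := hfin.
have [[a0 _]|A0] := pselect (exists a : A, True); last first.
  exists (fun=> 0); exists rho1, rho2; split=> //.
  by move=> u; case: A0; exists u.
have [[r1 m1] [r2 m2] cvg1] := rhoP.
(* The shift to [n.+1] keeps the radius positive, as local finiteness requires. *)
pose B (n : nat) : set A := [set a | mdist a0 a <= n.+1%:R].
have a0B n : B n a0 by rewrite /B/= mdistxx.
have [g gP] : exists g : nat -> A -> X, forall n u v, B n u -> B n v ->
    rho1 (mdist u v) <= `|g n u - g n v| <= rho2 (mdist u v).
  suff /choice : forall n, exists h : A -> X, forall u v, B n u -> B n v ->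
    rho1 (mdist u v) <= `|h u - h v| <= rho2 (mdist u v).
    by move=> [g gP]; exists g.
  move=> n; have [|h hP] := emb (B n); first by apply: finA; rewrite ltr0n.
  exists (fun u => if pselect (u \in B n) is left p then h (SigSub p) else 0).
  move=> u v /mem_set uB /mem_set vB.
  case: pselect => // p; case: pselect => // q.
  exact: hP (SigSub p) (SigSub q).
(* Translating [a0] to the origin bounds [F n u] by [rho2 (mdist u a0)] uniformly in [n]; the value
   0 outside the ball respects this bound. *)
pose F n u := if u \in B n then g n u - g n a0 else 0.
have FE n u v : B n u -> B n v -> F n u - F n v = g n u - g n v.
  by move=> /mem_set uB /mem_set vB; rewrite /F uB vB opprB addrA subrK.
have F0 n : F n a0 = 0 by rewrite /F subrr if_same.
have bF u : bounded_vec (fun n => F n u).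
  exists (rho2 (mdist u a0)) => n; rewrite /F; case: ifPn => [/set_mem uB|_].
    by have /andP[] := gP n u a0 uB (a0B n).
  by rewrite normr0 r2// mdist_ge0.
(* Refining the filter at infinity puts any two given points in [B n] for almost all [n]. *)
have [U [UU ooU]] := ultraFilterLemma (F := \oo) _.
have UP : ProperFilter U by exact: ultra_proper.
have UB u v : \forall n \near U, B n u /\ B n v.
  apply: ooU; near=> n.
  by split; rewrite /B/= (@le_trans _ _ n%:R) ?ler_nat//; near: n; exact: nbhs_infty_ger.
have Fr1 u v : rho1 (mdist u v) <= ulim U (fun n => `|F n u - F n v|).
  rewrite -[leLHS](ulim_cst U); apply: ulim_le_near.
  - exact: bounded_fam_cst.
  - have [M FM] := bF u; have [M' FM'] := bF v; exists (M + M') => n.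
    by rewrite normr_id (le_trans (ler_normB _ _))// lerD.
  - apply: filterS (UB u v) => n [uB vB]; rewrite FE//.
    by have /andP[] := gP n u v uB vB.
have [|||f fP] := @gluing R A nat X U UU F a0 (fun u v => rho2 (mdist u v)) F0 bF.
- by move=> u v; rewrite metric_sym.
- move=> u v; apply: filterS (UB u v) => n [uB vB]; rewrite FE//.
  by have /andP[] := gP n u v uB vB.
(* Since [rho1 (mdist a0 u)] is at most the limit norm of [F n u] and [rho1] diverges, a bound on
   this norm confines [u] to a ball, which is finite. *)
- move=> r; move/cvgryPgt : cvg1 => /(_ r) [M [_ Mr]].
  apply: sub_finite_set (finA a0 (Num.max M 1) _); last by rewrite lt_max ltr01 orbT.
  move=> u /= Nr; rewrite leNgt; apply/negP; rewrite gt_max => /andP[/Mr].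
  move=> /= rM _; have := lt_le_trans rM (Fr1 a0 u).
  rewrite ltNge => /negP; apply; rewrite (le_trans _ Nr)// le_eqVlt; apply/orP; left.
  by apply/eqP; congr (ulim U _); apply/funext => n; rewrite F0 sub0r normrN.
(* Solves the bound [20 * d + 4] of [gluing] for [d]; the maximum with 0 keeps the control
   nonnegative. *)
exists f; exists (fun t => Num.max 0 ((rho1 t - 4) / 20)).
exists (fun t => (1 + 2 / ln 28) * rho2 t); split.
  apply: coarse_controls_affine => //.
  by rewrite addr_ge0// divr_ge0// ln_ge0// ler1n.
move=> u v; rewrite /norm_dist; have [lo ->] := fP u v; rewrite andbT.
rewrite ge_max normr_ge0/= ler_pdivrMr//.
have := Fr1 u v; lra.
Unshelve. all: by end_near.
Qed.
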